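(* Let $I\subset\mathbb{R}$ be a nondegenerate interval, let $D:I^2\to\mathbb{R}$ be a deviation and let $(\xi_n)_{n\in\mathbb{N}}$ be a sequence of independent and identically distributed (real) random variables. Assume that (i) $D$ is Borel measurable in the first variable; (ii) $\mathbb{P}(\xi_1\in I)=1$ and for each $x\in I$, the random variable $D(\xi_1,x)$ is nondegenerate; (iii) for each $c>0$ and $x\in I$, we have $\varphi(c,x):=\mathbb{E}(\mathrm{e}^{cD(\xi_1,x)})<\infty$; (iv) there exists a point $t_0\in I_{\xi_1}^D$ such that $\mathbb{E}(D(\xi_1,t_0))=0$, i.e., $t_0=\mathbb{M}^D(\xi_1)$. Then for each $x\in I$ with $x>t_0$ and $\operatorname{ess\,sup}(D(\xi_1,x))>0$, we have $$\lim_{n\to\infty}\frac1n\ln\Big(\mathbb{P}\big(\mathscr{M}_n^{D}(\xi_1,\ldots,\xi_n)\geq x\big)\Big)=\sup_{m\in\mathbb{N}}\frac1m\ln\Big(\mathbb{P}\big(\mathscr{M}_m^{D}(\xi_1,\ldots,\xi_m)\geq x\big)\Big)=\inf_{c>0}\ln\big(\varphi(c,x)\big).$$ Equivalently, in exponential form, $$\lim_{n\to\infty}\sqrt[n]{\mathbb{P}\big(\mathscr{M}_n^{D}(\xi_1,\ldots,\xi_n)\geq x\big)}=\sup_{m\in\mathbb{N}}\sqrt[m]{\mathbb{P}\big(\mathscr{M}_m^{D}(\xi_1,\ldots,\xi_m)\geq x\big)}=\inf_{c>0}\varphi(c,x).$$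
   Context: All random variables are defined on a probability space $(\Omega,\mathcal{F},\mathbb{P})$. An interval is nondegenerate if it contains at least two distinct points. A random variable is nondegenerate if it is not almost surely constant. For a random variable $\eta$, $\operatorname{ess\,sup}(\eta):=\sup\{x\in\mathbb{R}:\mathbb{P}(\eta\leq x)<1\}$. A function $D:I^2\to\mathbb{R}$ is a deviation if (a) for all $x\in I$, the function $I\ni t\mapsto D(x,t)$ is strictly decreasing and continuous, and (b) $D(t,t)=0$ for all $t\in I$. $D$ is Borel measurable in the first variable if, for all $t\in I$, the function $I\ni x\mapsto D(x,t)$ is Borel measurable. For $n\in\mathbb{N}$ and $x_1,\dots,x_n\in I$, the deviation mean $\mathscr{M}_n^D(x_1,\dots,x_n)$ is the unique solution $t\in I$ of $\sum_{i=1}^n D(x_i,t)=0$ (it exists, is unique, and lies in $[\min_i x_i,\max_i x_i]$). Since $\mathbb{P}(\xi_i\in I,\ i\in\mathbb{N})=1$, $\mathscr{M}_n^D(\xi_1,\dots,\xi_n)$ is defined almost surely. For a random variable $\xi$ with $\mathbb{P}(\xi\in I)=1$ let $I_\xi^D:=\{t\in I : \mathbb{E}(|D(\xi,t)|)<\infty\}$, which is a (possibly degenerate) subinterval of $I$. If there exists $t_0\in I_\xi^D$ with $\mathbb{E}(D(\xi,t_0))=0$, then it is unique and is called the $D$-deviation mean of $\xi$, denoted by $\mathbb{M}^D(\xi)$. *)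

(* Defs.v *)
From HB Require Import structures.
From mathcomp Require Import all_boot all_order all_algebra.
From mathcomp Require Import finmap.
From mathcomp Require Import all_classical all_reals all_analysis.

Set Implicit Arguments.
Unset Strict Implicit.
Unset Printing Implicit Defensive.

Import Order.TTheory GRing.Theory Num.Theory numFieldNormedType.Exports.

Local Open Scope classical_set_scope.
Local Open Scope ring_scope.

Section DeviationMeans.
Context {R : realType}.
Implicit Types (I : set R) (D : R -> R -> R).

Definition nondegenerate_interval I : Prop :=
  is_interval I /\ exists a b, [/\ I a, I b & a != b].

(* A function on I^2 is given by D : R -> R -> R; its values off I^2 are
   arbitrary and play no role. *)
Definition deviation I D : Prop :=
  [/\ forall x, I x -> forall s t, I s -> I t -> s < t -> D x t < D x s,
      forall x, I x -> {within I, continuous (D x)}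
    & forall t, I t -> D t t = 0].

Definition borel_in_first_variable I D : Prop :=
  forall t, I t -> measurable_fun I (D ^~ t).

(* The root is unique when 0 < n, D is a deviation and all the x i lie in I;
   otherwise the value is irrelevant. *)
Definition deviation_mean I D n (x : 'I_n -> R) : R :=
  get [set t | I t /\ \sum_(i < n) D (x i) t = 0].

Section RandomVariables.
Context {d : measure_display} {T : measurableType d} (P : probability T R).

Definition nondegenerate_rv (X : T -> R) : Prop :=
  ~ exists c : R, \forall w \ae P, X w = c.

Definition esssup (X : T -> R) : \bar R :=
  ereal_sup [set x%:E | x in [set x : R | (P [set w | (X w <= x)%R] < 1)%E]].

Definition mutually_independent (X : nat -> T -> R) : Prop :=
  forall (J : {fset nat}) (A : nat -> set R),
    (forall i, measurable (A i)) ->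
    P (\bigcap_(i in [set` J]) (X i @^-1` A i))
    = (\prod_(i <- J) P (X i @^-1` A i))%E.

Definition identically_distributed (X : nat -> T -> R) : Prop :=
  forall (i j : nat) (A : set R), measurable A ->
    P (X i @^-1` A) = P (X j @^-1` A).

(* The random variable D(X, t), where P(X \in I) = 1; it is set to 0 on the
   null event X \notin I, where D(X, t) is not defined. *)
Definition deviation_rv I D (X : T -> R) (t : R) : T -> R :=
  fun w => ((D ^~ t) \_ I) (X w).

Definition deviation_domain I D (X : T -> R) : set R :=
  [set t | I t /\ ('E_P[fun w => `|deviation_rv I D X t w|%R] < +oo)%E].

Definition is_deviation_mean_rv I D (X : T -> R) (t0 : R) : Prop :=
  deviation_domain I D X t0 /\ ('E_P[deviation_rv I D X t0] = 0)%E.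

Definition deviation_mgf I D (X : T -> R) (c x : R) : \bar R :=
  ('E_P[fun w => expR (c * deviation_rv I D X x w)%R])%E.

(* The event that the deviation mean of X 0, ..., X n.-1 is at least x; this
   mean is defined only when these variables all take their value in I. *)
Definition deviation_mean_ge I D (X : nat -> T -> R) (n : nat) (x : R) : set T :=
  [set w | (forall i : 'I_n, I (X i w)) /\
           x <= deviation_mean I D (fun i : 'I_n => X i w)].

End RandomVariables.
End DeviationMeans.

(* Main.v *)
Require Import Defs.
From HB Require Import structures.
From mathcomp Require Import all_boot all_order all_algebra.
From mathcomp Require Import finmap ring lra.
From mathcomp Require Import all_classical all_reals all_analysis.
From mathcomp Require Import measurable_realfun.

Set Implicit Arguments.
Unset Strict Implicit.
Unset Printing Implicit Defensive.

Import Order.TTheory GRing.Theory Num.Theory numFieldNormedType.Exports.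

Local Open Scope classical_set_scope.
Local Open Scope ring_scope.

(* Put Y_i = D(xi_i, x) and S_n = Y_1 + ... + Y_n.  A deviation is strictly
   decreasing in its second variable, so the deviation mean of xi_1, ..., xi_n is at
   least x iff S_n >= 0, and the claim is Cramer's theorem at 0 for
   M(c) = E(exp(c Y_1)).  Markov's inequality gives P(S_n >= 0) <= M(c)^n for all
   c > 0.  Conversely, for 0 < h < c, integrating
     exp(c S_n) <= exp((c-h) S_n) + exp(-n eps h) exp((c+h) S_n)
                   + exp(n c eps) 1_{S_n >= 0}
   bounds M(c)^n by M(c-h)^n + (exp(-eps h) M(c+h))^n + exp(n c eps) P(S_n >= 0).
   When M(c-h) < M(c) and M(c+h) < exp(eps h) M(c), the first two terms are
   negligible.  Such c and h, with c bounded independently of eps, are found on a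
   fine grid just after M stops decreasing: M decreases somewhere because
   E(Y_1) < 0, it tends to infinity because ess sup Y_1 > 0, and its second
   differences are O(h^2). *)

(** * Expectation of a product of independent variables *)

Section IntegralProduct.
Context d (T : measurableType d) (R : realType).
Local Open Scope ereal_scope.
Import HBNNSimple.

(** The hypothesis on [\1_A] is the case of an indicator [G]; linearity extends it to simple
    functions and monotone convergence along [nnsfun_approx] to nonnegative [G]. It lets one factor
    of a product pass from indicators to general functions. *)
Lemma ge0_integralM_measure (mu : {measure set T -> \bar R}) (X : {mfun T >-> R})
    (V : T -> R) (G : R -> R) (c : R) :
  measurable_fun setT V -> (forall w, (0 <= V w)%R) -> (0 <= c)%R ->
  (forall A, measurable A -> \int[mu]_w (V w * \1_A (X w))%:E = c%:E * mu (X @^-1` A)) ->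
  measurable_fun setT G -> (forall t, (0 <= G t)%R) ->
  \int[mu]_w (V w * G (X w))%:E = c%:E * \int[mu]_w (G (X w))%:E.
Proof.
move=> mV V0 c0 VA mG G0.
have mGE : measurable_fun setT (fun t : R => (G t)%:E) by exact/measurable_EFinP.
pose h := nnsfun_approx measurableT mGE.
have hcvg t : (h n t)%:E @[n --> \oo] --> (G t)%:E.
  exact: (cvg_nnsfun_approx measurableT mGE (fun t _ => G0 t)) I.
have hnd t a b : (a <= b)%N -> (h a t <= h b t)%R.
  by move=> ab; exact: (lefP _ _ (nd_nnsfun_approx measurableT mGE ab)).
have mhX n : measurable_fun setT (fun w => h n (X w)).
  by apply: measurableT_comp => //; exact: measurable_funP.
have simple n : \int[mu]_w (V w * h n (X w))%:E = c%:E * \int[mu]_w (h n (X w))%:E.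
  transitivity (\int[mu]_w (\sum_(y \in range (h n))
      (y * (V w * \1_(h n @^-1` [set y]) (X w)))%:E)).
    apply: eq_integral => w _; rewrite fsumEFin//; congr EFin.
    rewrite {1}fimfunE mulr_fsumr//; apply: eq_fsbigr => y _.
    by rewrite mulrCA.
  have mI y : measurable_fun setT (fun w => \1_(h n @^-1` [set y]) (X w) : R).
    by apply: measurableT_comp => //; exact: measurable_funP.
  rewrite ge0_integral_fsum//; last 2 first.
  - by move=> y; apply/measurable_EFinP; do 2 (apply: measurable_funM => //).
  - move=> y w _; rewrite mulrCA EFinM mule_ge0 ?lee_fin//.
    exact: nnfun_muleindic_ge0.
  transitivity (c%:E * \int[mu]_w (\sum_(y \in range (h n))
      (y * \1_(h n @^-1` [set y]) (X w))%:E)); last first.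
    by congr (_ * _); apply: eq_integral => w _; rewrite fsumEFin// -fimfunE.
  rewrite ge0_integral_fsum//; last 2 first.
  - by move=> y; apply/measurable_EFinP; apply: measurable_funM.
  - by move=> y w _; exact: nnfun_muleindic_ge0.
  rewrite ge0_mule_fsumr; last first.
    by move=> y; apply: integral_ge0 => w _; exact: nnfun_muleindic_ge0.
  apply: eq_fsbigr => y /set_mem[t _ <-].
  have ht : (0 <= h n t)%R by [].
  under eq_integral do rewrite EFinM.
  rewrite ge0_integralZl_EFin//; last 2 first.
  - by move=> w _; rewrite lee_fin mulr_ge0.
  - by apply/measurable_EFinP; apply: measurable_funM.
  rewrite VA//.
  under [in RHS]eq_integral do rewrite EFinM.
  rewrite ge0_integralZl_EFin//; last exact/measurable_EFinP.
  rewrite muleCA; congr (_ * (_ * _)).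
  transitivity (\int[mu]_w (\1_(X @^-1` (h n @^-1` [set h n t])) w)%:E); last by [].
  by rewrite integral_indic ?setIT//; exact: measurable_funPTI.
have -> : \int[mu]_w (V w * G (X w))%:E =
    limn (fun n => \int[mu]_w (V w * h n (X w))%:E).
  rewrite -monotone_convergence//.
  - apply: eq_integral => w _; apply/esym/cvg_lim => //.
    under eq_fun do rewrite EFinM.
    by rewrite EFinM; apply: cvgeZl => //.
  - by move=> n; apply/measurable_EFinP; exact: measurable_funM.
  - by move=> n w _; rewrite lee_fin mulr_ge0.
  - by move=> w _ a b ab; rewrite lee_fin ler_wpM2l// hnd.
under eq_fun do rewrite simple.
have mono : {homo (fun n => \int[mu]_w (h n (X w))%:E) : a b / (a <= b)%N >-> a <= b}.
  move=> a b ab; apply: ge0_le_integral => //.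
  - by move=> w _; rewrite lee_fin.
  - exact/measurable_EFinP.
  - exact/measurable_EFinP.
  - by move=> w _; rewrite lee_fin hnd.
rewrite limeMl//; last exact: ereal_nondecreasing_is_cvgn.
congr (_ * _); rewrite -monotone_convergence//.
- by apply: eq_integral => w _; apply/cvg_lim => //; exact: hcvg.
- by move=> n; exact/measurable_EFinP.
- by move=> n w _; rewrite lee_fin.
- by move=> w _ a b ab; rewrite lee_fin hnd.
Qed.

End IntegralProduct.

Section IndependentProduct.
Context d (T : measurableType d) (R : realType) (P : probability T R).

Lemma integral_EFin_Rintegral (f : T -> R) :
  (forall w, 0 <= f w) -> (\int[P]_w (f w)%:E < +oo)%E ->
  (\int[P]_w (f w)%:E)%E = (\int[P]_w f w)%:E.
Proof.
move=> f0 fy; rewrite /Rintegral fineK// ge0_fin_numE//.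
by apply: integral_ge0 => w _; rewrite lee_fin.
Qed.

Lemma prod_indic (I : finType) (A : I -> set T) (w : T) :
  \prod_(i : I) (\1_(A i) w : R) = \1_(\bigcap_i A i) w.
Proof.
rewrite indicE; case: (asboolP (forall i, A i w)) => [Aw|/existsNP[i Aiw]].
  by rewrite mem_set ?big1// => i _; rewrite indicE mem_set.
rewrite (bigD1 i)//= indicE memNset// mul0r memNset// => Aw.
by apply: Aiw; exact: Aw.
Qed.

(* Induction on the number of factors that are not indicator functions. *)
Lemma independent_integral_prod (X : nat -> {RV P >-> R}) n (F : nat -> R -> R) :
  mutually_independent P X -> (forall i, measurable_fun setT (F i)) ->
  (forall i t, 0 <= F i t) -> (forall i, \int[P]_w (F i (X i w))%:E < +oo)%E ->
  (\int[P]_w (\prod_(i < n) F i (X i w))%:E)%E =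
  (\prod_(i < n) \int[P]_w F i (X i w))%:E.
Proof.
move=> indep.
suff H m : forall G : nat -> R -> R, (m <= n)%N ->
    (forall i, measurable_fun setT (G i)) ->
    (forall i t, 0 <= G i t) -> (forall i, \int[P]_w (G i (X i w))%:E < +oo)%E ->
    (forall i, (m <= i)%N -> exists2 A, measurable A & G i = \1_A) ->
    (\int[P]_w (\prod_(i < n) G i (X i w))%:E)%E =
    (\prod_(i < n) \int[P]_w G i (X i w))%:E.
  move=> mF F0 Fy.
  (* Only factors of index below [n] occur in the product; the others are made indicators so that
     [H] applies with [m = n]. *)
  pose G i := if (i < n)%N then F i else \1_setT.
  have GF (i : 'I_n) : G i = F i by rewrite /G ltn_ord.
  transitivity (\int[P]_w (\prod_(i < n) G i (X i w))%:E)%E.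
    by apply: eq_integral => w _; congr EFin; apply: eq_bigr => i _; rewrite GF.
  rewrite (H n)//.
  - by congr EFin; apply: eq_bigr => i _; rewrite GF.
  - by move=> i; rewrite /G; case: ifP.
  - by move=> i t; rewrite /G; case: ifP => // _; rewrite indicE.
  - move=> i; rewrite /G; case: ifP => // _.
    rewrite (eq_integral (cst 1%E)) => [|w _]; last by rewrite indicT.
    by rewrite integral_cst//= mul1e (le_lt_trans (probability_le1 _ _)) ?ltry.
  - by move=> i ni; exists setT => //; rewrite /G ltnNge ni.
elim: m => [|m IH] G mn mG G0 Gy Gind.
  (* Every factor is an indicator here, so the product is the indicator of an intersection, and
     independence applies to the set of indices below [n]. *)
  have /choice[A mGA] : forall i, exists A, measurable A /\ G i = \1_A.
    by move=> i; have [A] := Gind i (leq0n i); exists A.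
  have mA i : measurable (A i) := (mGA i).1.
  have GA i : G i = \1_(A i) := (mGA i).2.
  have mXA i : measurable (X i @^-1` A i) by exact: measurable_funPTI.
  transitivity (\int[P]_w (\1_(\bigcap_(i : 'I_n) (X i @^-1` A i)) w)%:E)%E.
    apply: eq_integral => w _; congr EFin; rewrite -prod_indic.
    by apply: eq_bigr => i _; rewrite GA.
  rewrite integral_indic//; last first.
    by apply: fin_bigcap_measurable => //; exact: finite_finset.
  rewrite setIT.
  have := indep [fset i in iota 0 n]%fset A mA.
  have -> : \bigcap_(i in [set` [fset i in iota 0 n]%fset]) (X i @^-1` A i) =
      \bigcap_(i : 'I_n) (X i @^-1` A i).
    apply/seteqP; split => w /= Aw i.
      by move=> _; apply: Aw; rewrite /= !inE mem_iota/= ltn_ord.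
    by rewrite /= !inE mem_iota/= add0n => lin; exact: (Aw (Ordinal lin)).
  move=> PA; apply: (etrans PA); rewrite (perm_big (iota 0 n)); last first.
    by apply: uniq_perm; rewrite ?iota_uniq ?fset_uniq// => i; rewrite !inE.
  rewrite -[n in iota 0 n]subn0 big_mkord.
  rewrite (eq_bigr (fun i : 'I_n => (\int[P]_w G i (X i w))%:E)) ?prodEFin//.
  move=> i _; rewrite -integral_EFin_Rintegral// GA.
  transitivity (\int[P]_w (\1_(X i @^-1` A i) w)%:E)%E; last by [].
  by rewrite integral_indic ?setIT.
pose k := Ordinal mn.
pose V w := \prod_(i < n | i != k) G i (X i w).
pose c := \prod_(i < n | i != k) \int[P]_w G i (X i w).
have mGX i : measurable_fun setT (fun w => G i (X i w)).
  by apply: measurableT_comp => //; exact: measurable_funP.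
transitivity (\int[P]_w (V w * G m (X m w))%:E)%E.
  by apply: eq_integral => w _; congr EFin; rewrite (bigD1 k)//= mulrC.
rewrite (@ge0_integralM_measure _ _ _ P (X m) V (G m) c)//.
- by rewrite integral_EFin_Rintegral// -EFinM (bigD1 k)//= mulrC.
- rewrite /V; under eq_fun do rewrite big_mkcond/=.
  by apply: measurable_prod => i _; case: (i != k).
- by move=> w; exact: prodr_ge0.
- by apply: prodr_ge0 => i _; exact: Rintegral_ge0.
(* With [\1_A] in position [m], only indices below [m] can carry a non-indicator, so the induction
   hypothesis gives the identity that [ge0_integralM_measure] asks for. *)
move=> A mA; pose G' i := if i == m then \1_A else G i.
have G'G (i : 'I_n) : i != k -> G' i = G i.
  by move=> ik; rewrite /G' ifN.
have G'm : G' m = \1_A by rewrite /G' eqxx.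
have mXA : measurable (X m @^-1` A) by exact: measurable_funPTI.
have intA : (\int[P]_w (\1_A (X m w))%:E)%E = P (X m @^-1` A).
  transitivity (\int[P]_w (\1_(X m @^-1` A) w)%:E)%E; first by [].
  by rewrite integral_indic ?setIT.
have intAy : (\int[P]_w (\1_A (X m w))%:E < +oo)%E.
  by rewrite intA (le_lt_trans (probability_le1 _ _)) ?ltry.
transitivity (\int[P]_w (\prod_(i < n) G' i (X i w))%:E)%E.
  apply: eq_integral => w _; congr EFin; rewrite (bigD1 k)//= G'm mulrC.
  by congr (_ * _); apply: eq_bigr => i ik; rewrite G'G.
rewrite IH//.
- rewrite (bigD1 k)//= G'm mulrC EFinM -integral_EFin_Rintegral// intA.
  by congr (_%:E * _)%E; apply: eq_bigr => i ik; rewrite G'G.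
- exact: ltnW.
- by move=> i; rewrite /G'; case: ifP.
- by move=> i t; rewrite /G'; case: ifP => // _; rewrite indicE.
- by move=> i; rewrite /G'; case: eqP => [->|].
- move=> i mi; rewrite /G'; case: eqP => [_|/eqP im]; first by exists A.
  by apply: Gind; rewrite ltn_neqAle eq_sym im.
Qed.

End IndependentProduct.

(** * Exponential inequalities and the choice of the parameters *)

Section ExponentialBounds.
Context {R : realType}.
Implicit Types (u y c h s a b t : R) (f : R -> R).

(** Both sides are even, and for [0 <= u] one squares [u / 2 <= expR (u / 2)]. This later absorbs
    the factor [y ^+ 2] of a second difference into exponentials. *)
Lemma sqr_le_expR u : u ^+ 2 <= 4 * (expR u + expR (- u)).
Proof.
wlog u0 : u / 0 <= u => [H|].
  have [/H//|/ltW u0] := leP 0 u.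
  by have := H (- u); rewrite oppr_ge0 opprK sqrrN => /(_ u0); lra.
have v0 : 0 <= u / 2 by lra.
have e1 : u / 2 <= expR (u / 2) by have := expR_ge1Dx (u / 2); lra.
have -> : expR u = expR (u / 2) ^+ 2 by rewrite expr2 -expRD; congr expR; lra.
have := expR_gt0 (- u).
have : (u / 2) ^+ 2 <= expR (u / 2) ^+ 2 by rewrite lerXn2r// nnegrE expR_ge0.
by rewrite !expr2; lra.
Qed.

(** For [v = u / 2 >= 0], the left side minus [2] is [(expR v - expR (- v)) ^+ 2], and the
    difference being squared is at most [2 * v * expR v] because [1 - 2 * v <= expR (- (2 * v))]. *)
Lemma expR_second_difference u :
  expR u + expR (- u) <= 2 + u ^+ 2 * (expR u + expR (- u)).
Proof.
wlog u0 : u / 0 <= u => [H|].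
  have [/H//|/ltW u0] := leP 0 u.
  by have := H (- u); rewrite oppr_ge0 opprK sqrrN => /(_ u0); lra.
set v := u / 2; have v0 : 0 <= v by rewrite /v; lra.
have -> : u = v + v by rewrite /v; lra.
have E1 : expR v * expR (- v) = 1 by rewrite -expRD subrr expR0.
have E2 : 1 - 2 * v <= expR (- v) * expR (- v).
  by rewrite -expRD; have := expR_ge1Dx (- v - v); lra.
have -> : - (v + v) = - v - v by lra.
have zx : expR (- v) <= expR v by rewrite ler_expR; lra.
rewrite !expRD; move: (expR_gt0 v) (expR_gt0 (- v)) E1 E2 zx.
move: (expR v) (expR (- v)) => x z x0 z0 E1 E2 zx.
have xz : x - z <= 2 * v * x.
  have -> : x - z = x * (1 - z * z) by rewrite mulrBr mulr1 mulrA E1 mul1r.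
  by nra.
have : (x - z) ^+ 2 <= (2 * v * x) ^+ 2 by rewrite lerXn2r// nnegrE; nra.
rewrite !expr2 => H.
have : 0 <= (v + v) * (v + v) * (z * z) by rewrite mulr_ge0// mulr_ge0; lra.
by nra.
Qed.

Lemma expR_between a b t y : a <= t -> t <= b ->
  expR (t * y) <= expR (a * y) + expR (b * y).
Proof.
move=> at_ tb; have [y0|/ltW y0] := leP 0 y.
  rewrite (@le_trans _ _ (expR (b * y)))// ?lerDr ?expR_ge0//.
  by rewrite ler_expR ler_wpM2r.
rewrite (@le_trans _ _ (expR (a * y)))// ?lerDl ?expR_ge0//.
by rewrite ler_expR ler_wnM2r.
Qed.

(** The second difference at [h * y] leaves a factor [y ^+ 2], which costs [4 / s ^+ 2] and the
    exponents [s] and [- s]. Expanding gives four exponentials with exponents within [2 * s] of [c],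
    each dominated by the two endpoints; hence [16 = 4 * 4]. The bound is uniform in [c], as a grid
    argument requires. *)
Lemma expR_scaled_second_difference a b s c h y :
  0 < h <= s -> a <= c - 2 * s -> c + 2 * s <= b ->
  expR ((c + h) * y) + expR ((c - h) * y) <=
  2 * expR (c * y) + h ^+ 2 * (16 / s ^+ 2 * (expR (a * y) + expR (b * y))).
Proof.
move=> /andP[h0 hs] ac cb; have s0 : 0 < s by lra.
have H1 := expR_second_difference (h * y).
have H2 : y ^+ 2 <= 4 / s ^+ 2 * (expR (s * y) + expR (- (s * y))).
  have := sqr_le_expR (s * y); rewrite exprMn => H.
  by rewrite mulrAC ler_pdivlMr ?exprn_gt0// mulrC.
have B t : - (2 * s) <= t <= 2 * s ->
    expR (c * y) * expR (t * y) <= expR (a * y) + expR (b * y).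
  by move=> /andP[? ?]; rewrite -expRD -mulrDl; apply: expR_between; lra.
have {}B : expR (c * y) * ((expR (s * y) + expR (- (s * y))) *
    (expR (h * y) + expR (- (h * y)))) <= 4 * (expR (a * y) + expR (b * y)).
  set Z := _ + _ in B *.
  have B1 : expR (c * y) * (expR (h * y) * expR (s * y)) <= Z.
    by rewrite -expRD -mulrDl; apply: B; lra.
  have B2 : expR (c * y) * (expR (h * y) * expR (- (s * y))) <= Z.
    by rewrite -expRD -mulrBl; apply: B; lra.
  have B3 : expR (c * y) * (expR (- (h * y)) * expR (s * y)) <= Z.
    by rewrite -expRD -mulNr -mulrDl; apply: B; lra.
  have B4 : expR (c * y) * (expR (- (h * y)) * expR (- (s * y))) <= Z.
    by rewrite -expRD -!mulNr -mulrDl; apply: B; lra.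
  by lra.
have -> : (c + h) * y = c * y + h * y by rewrite mulrDl.
have -> : (c - h) * y = c * y - h * y by rewrite mulrBl.
rewrite !expRD; set Ec := expR (c * y) in B *.
set Eh := expR (h * y) + expR (- (h * y)) in H1 B *.
set Es := expR (s * y) + expR (- (s * y)) in H2 B *.
have Ec0 : 0 < Ec := expR_gt0 _.
have Eh0 : 0 < Eh by rewrite addr_gt0// expR_gt0.
rewrite -mulrDr -/Eh (le_trans (ler_wpM2l (ltW Ec0) H1))// mulrDr [Ec * 2]mulrC.
rewrite lerD2l exprMn.
rewrite (_ : Ec * _ = h ^+ 2 * (Ec * Eh * y ^+ 2)); last by ring.
rewrite ler_wpM2l ?sqr_ge0//.
apply: le_trans (ler_wpM2l _ H2) _; first by rewrite mulr_ge0// ltW.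
have -> : Ec * Eh * (4 / s ^+ 2 * Es) = 4 / s ^+ 2 * (Ec * (Es * Eh)) by ring.
have -> : 16 / s ^+ 2 * (expR (a * y) + expR (b * y)) =
    4 / s ^+ 2 * (4 * (expR (a * y) + expR (b * y))) by ring.
by rewrite ler_wpM2l// divr_ge0// sqr_ge0.
Qed.

(** Take the least [j] with [u j < u 0]; the sequence does not increase on reaching [j]. Without a
    turning point the descent would continue up to [M] and keep [u M] below [u 0]. *)
Lemma exists_turning_point (u : nat -> R) N M : (N <= M)%N ->
  u N < u 0%N -> u 0%N < u M ->
  exists2 k, (0 < k < M)%N & u k <= u k.-1 /\ u k < u k.+1.
Proof.
move=> NM uN uM; apply: contrapT => noturn.
have turn k : (0 < k < M)%N -> u k <= u k.-1 -> u k.+1 <= u k.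
  by move=> kM uk; rewrite leNgt; apply/negP => uk1; apply: noturn; exists k.
have exj : exists j, u j < u 0%N by exists N.
case: (ex_minnP exj) => j uj jmin.
have j0 : (0 < j)%N by case: j uj {jmin} => //; rewrite ltxx.
have jM : (j <= M)%N by rewrite (leq_trans (jmin _ uN)).
have ujp : u j <= u j.-1.
  rewrite (le_trans (ltW uj))// leNgt; apply/negP => /jmin.
  by rewrite leqNgt ltn_predL j0.
suff H k : (j <= k <= M)%N -> u k <= u k.-1 /\ u k < u 0%N.
  by have [|_] := H M; [rewrite jM leqnn|rewrite ltNge ltW].
elim: k => [|k IH]; first by case/andP; rewrite leqn0 => /eqP j00; rewrite j00 in j0.
rewrite leq_eqVlt => /andP[/predU1P[<-//|jk] kM].
have [|uk uk0] := IH; first by rewrite -ltnS jk ltnW.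
have uk1 : u k.+1 <= u k by apply: turn => //; rewrite (leq_trans j0).
by split => //; rewrite (le_lt_trans uk1).
Qed.

(* At the first turning point of [f] on a fine grid the increments are of order
   [h ^+ 2], hence negligible against [eps * h]. *)
Lemma exists_flat_increase f a b (m : nat) q K s :
  0 < a < b -> f b < f a -> f a < f (a + m%:R * (b - a)) ->
  0 < q -> (forall c, 0 < c -> q <= f c) -> 0 < s ->
  (forall c h, a <= c <= a + m%:R * (b - a) -> 0 < h <= s ->
    f (c + h) + f (c - h) <= 2 * f c + h ^+ 2 * K) ->
  forall eps, 0 < eps -> exists c h,
    [/\ 0 < h < c, c <= a + m%:R * (b - a), f (c - h) < f c
      & f (c + h) < expR (eps * h) * f c].
Proof.
move=> /andP[a0 ab] fba fam q0 qf s0 f2 eps eps0.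
(* The first summand will force [h <= s], the second [2 * |K| * h < eps * q]. Dividing [b - a] by an
   integer puts both [b] and [a + m * (b - a)] on the grid, at the indices [N] and [m * N]. *)
pose B := (b - a) / s + 2 * `|K| * (b - a) / (eps * q) + 1.
have d0 : 0 < b - a by lra.
have B0 : 0 <= B.
  by rewrite !addr_ge0// ?divr_ge0 ?mulr_ge0// ltW.
pose N := Num.bound B; have BN : B < N%:R by exact: archi_boundP.
have N0 : 0 < N%:R :> R by exact: le_lt_trans BN.
pose h := (b - a) / N%:R; have h0 : 0 < h by rewrite divr_gt0.
have NhE : N%:R * h = b - a by rewrite /h mulrC divfK ?gt_eqF.
have hs : h <= s.
  rewrite ler_pdivrMr// mulrC -ler_pdivrMr// (le_trans _ (ltW BN))// /B -addrA.
  by rewrite lerDl addr_ge0// divr_ge0 ?mulr_ge0// ltW.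
have hK : 2 * `|K| * h < eps * q.
  rewrite /h mulrA ltr_pdivrMr// [eps * q * _]mulrC -ltr_pdivrMr ?mulr_gt0//.
  rewrite (le_lt_trans _ BN)// /B addrAC lerDr addr_ge0// divr_ge0// ltW//.
pose u j := f (a + j%:R * h).
have m0 : (0 < m)%N.
  by case: m fam {f2} => //; rewrite mul0r addr0 ltxx.
have uN : u N < u 0%N by rewrite /u NhE mul0r addr0 addrC subrK.
have mNE : (m * N)%:R * h = m%:R * (b - a) by rewrite natrM -mulrA NhE.
have uM : u 0%N < u (m * N)%N by rewrite /u mNE mul0r addr0.
have [k /andP[k0 kM] [uk uk1]] :=
  exists_turning_point (leq_pmull N m0) uN uM.
have grid j : (j <= m * N)%N -> a <= a + j%:R * h <= a + m%:R * (b - a).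
  move=> jM; rewrite lerDl mulr_ge0 ?(ltW h0)//= lerD2l -mNE.
  by rewrite ler_wpM2r ?(ltW h0)// ler_nat.
have next j : a + j%:R * h + h = a + j.+1%:R * h by rewrite -natr1; ring.
have prev j : a + j.+1%:R * h - h = a + j%:R * h by rewrite -natr1; ring.
have h2 j : (j.+1 <= m * N)%N -> u j.+2 + u j <= 2 * u j.+1 + h ^+ 2 * `|K|.
  move=> jM; have := f2 (a + j.+1%:R * h) h (grid _ jM); rewrite next prev.
  rewrite h0 hs => /(_ isT)/le_trans; apply.
  by rewrite lerD2l ler_wpM2l ?sqr_ge0// ler_norm.
case: k k0 kM uk uk1 => // k _ kM uk uk1.
have c0 j : 0 < a + j%:R * h by rewrite ltr_wpDr// mulr_ge0// ltW.
(* The turn is at index [k.+1], and [c] is the next grid point, where [f] has just increased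
   strictly. Two second differences bound this increment by [h ^+ 2 * |K|] and the following one by
   twice that. Index [k.+3] may leave the grid, but the hypothesis on [c + h] still covers it. *)
exists (a + k.+2%:R * h), h; rewrite prev next; split.
- rewrite h0/= -next; have := c0 k.+1; lra.
- by have /andP[] := grid k.+2 kM.
- exact: uk1.
have := h2 k (ltnW kM); have := h2 k.+1 kM => H2 H1.
have H3 : u k.+3 <= u k.+2 + 2 * `|K| * h * h by move: uk uk1; rewrite expr2 in H1 H2; lra.
rewrite (le_lt_trans H3)//.
have qu : q <= u k.+2 by exact: qf.
have q1 : 2 * `|K| * h * h < eps * q * h by rewrite ltr_pM2r.
have q2 : (1 + eps * h) * u k.+2 <= expR (eps * h) * u k.+2.
  by rewrite ler_wpM2r ?expR_ge1Dx// (le_trans (ltW q0)).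
have q3 : eps * h * q <= eps * h * u k.+2 by rewrite ler_wpM2l// mulr_ge0// ltW.
by rewrite -/(u _); lra.
Qed.

(** In the three-term bound, the first two terms are geometric with ratios below [f c], so each is
    eventually at most a third of [f c ^+ n]; the last term must make up the remaining third. *)
Lemma eventually_geometric_le (p : nat -> R) f (rho C : R) :
  (forall c, 0 < c -> rho <= f c) -> 0 < C ->
  (forall eps, 0 < eps -> exists c h,
    [/\ 0 < h < c, c <= C, f (c - h) < f c & f (c + h) < expR (eps * h) * f c]) ->
  (forall n c h eps, 0 < h < c -> f c ^+ n <=
    f (c - h) ^+ n + (expR (- (eps * h)) * f (c + h)) ^+ n
    + expR (c * eps) ^+ n * p n) ->
  forall r, 0 < r < rho -> \forall n \near \oo, r ^+ n <= p n.
Proof.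
move=> rhof C0 flat lower r /andP[r0 rrho].
have rho0 : 0 < rho by exact: lt_trans rrho.
have l0 : 0 < ln (rho / r) by rewrite ln_gt0// ltr_pdivlMr// mul1r.
(* Chosen so that [expR (c * eps) * r < rho] for every [c <= C]. As [c] is obtained only after
   [eps], the bound [C] must not depend on [eps]. *)
pose eps := ln (rho / r) / (2 * C).
have eps0 : 0 < eps by rewrite divr_gt0// mulr_gt0.
have [c [h [/andP[h0 hc] cC f1 f2]]] := flat _ eps0.
have c0 : 0 < c by exact: lt_trans hc.
have fc : 0 < f c by rewrite (lt_le_trans rho0)// rhof.
have rc : expR (c * eps) * r < f c.
  rewrite (lt_le_trans _ (rhof _ c0))// -ltr_pdivlMr//.
  rewrite -[ltRHS]lnK ?posrE ?divr_gt0// ltr_expR (@le_lt_trans _ _ (C * eps))//.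
    by rewrite ler_wpM2r// ltW.
  have -> : C * eps = ln (rho / r) / 2 by rewrite /eps; field; rewrite gt_eqF.
  lra.
have f3 : expR (- (eps * h)) * f (c + h) < f c.
  by rewrite expRN mulrC ltr_pdivrMr ?expR_gt0// mulrC.
pose x := f (c - h); pose y := expR (- (eps * h)) * f (c + h).
pose z := expR (c * eps) * r.
have x0 : 0 < x by rewrite (lt_le_trans rho0)// rhof// subr_gt0.
have y0 : 0 < y by rewrite mulr_gt0 ?expR_gt0// (lt_le_trans rho0)// rhof// addr_gt0.
have z0 : 0 < z by rewrite mulr_gt0 ?expR_gt0.
have small t : 0 < t -> t < f c -> \forall n \near \oo, t ^+ n <= f c ^+ n / 3.
  move=> t0 tf.
  have : (t / f c) ^+ n @[n --> \oo] --> (0 : R).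
    by apply: cvg_expr; rewrite ger0_norm ?divr_ge0 ?ltW// ltr_pdivrMr ?mul1r.
  move=> /cvgr_lt/(_ 3^-1); rewrite invr_gt0 ltr0n => /(_ isT).
  apply: filterS => n; rewrite expr_div_n ltr_pdivrMr ?exprn_gt0// => /ltW.
  by rewrite mulrC.
have Hx := small _ x0 f1; have Hy := small _ y0 f3; have Hz := small _ z0 rc.
near=> n.
have nx : x ^+ n <= f c ^+ n / 3 by near: n.
have ny : y ^+ n <= f c ^+ n / 3 by near: n.
have nz : z ^+ n <= f c ^+ n / 3 by near: n.
have H := lower n c h eps; rewrite h0 hc in H; have {}H := H isT.
have : expR (c * eps) ^+ n * r ^+ n <= expR (c * eps) ^+ n * p n.
  rewrite -exprMn -/z; rewrite -/x -/y in H; lra.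
by rewrite ler_pM2l// exprn_gt0// expR_gt0.
Unshelve. all: by end_near. Qed.

End ExponentialBounds.

(** * From geometric bounds to limits and suprema of rates and roots *)

Section GeometricRate.
Context {R : realType}.
Implicit Types (u p : nat -> \bar R) (rho l r : R).

(** The upper bound holds at every positive index, so the supremum cannot exceed the limit; the
    asymptotic lower bound yields the rest of both claims. *)
Lemma cvg_ereal_sup u l :
  (forall n, (0 < n)%N -> (u n <= l%:E)%E) ->
  (forall e : R, 0 < e -> \forall n \near \oo, ((l - e)%:E <= u n)%E) ->
  ereal_sup [set u m | m in [set m | (0 < m)%N]] = l%:E /\ u @ \oo --> l%:E.
Proof.
move=> ul lu; split.
  apply/eqP; rewrite eq_le; apply/andP; split.
    by apply: ge_ereal_sup => _ [m m0 <-]; exact: ul.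
  apply/lee_addgt0Pr => e e0.
  have [N _ HN] := lu _ e0.
  (* The index is [N.+1] because [N] may be 0, while the supremum runs over positive indices. *)
  rewrite -leeBlDr// -EFinB (le_trans (HN N.+1 (leqnSn N)))//.
  by apply: ereal_sup_ubound; exists N.+1.
have uln : \forall n \near \oo, (u n <= l%:E)%E by exists 1%N.
have fin : \forall n \near \oo, u n \is a fin_num.
  near=> n; rewrite fin_numElt; apply/andP; split.
    by rewrite (@lt_le_trans _ _ (l - 1)%:E) ?ltNyr//; near: n; exact: lu.
  by rewrite (@le_lt_trans _ _ l%:E) ?ltry//; near: n.
apply/fine_cvgP; split => //; apply/cvgrPdist_le => e e0.
have lue := lu _ e0.
near=> n; have un : u n \is a fin_num by near: n.
have u1 : (u n <= l%:E)%E by near: n.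
have u2 : ((l - e)%:E <= u n)%E by near: n.
rewrite -(fineK un) lee_fin in u1; rewrite -(fineK un) lee_fin in u2.
by rewrite /= ger0_norm ?subr_ge0//; lra.
Unshelve. all: by end_near. Qed.

(** At a positive index both transformations are monotone and send [r ^+ n] to [ln r] and [r]
    respectively, so the geometric bounds on [p] become the hypotheses of [cvg_ereal_sup]. *)
Lemma geometric_rate p rho : 0 < rho ->
  (forall n, (0 <= p n)%E) ->
  (forall n, (0 < n)%N -> (p n <= (rho ^+ n)%:E)%E) ->
  (forall r, 0 < r < rho -> \forall n \near \oo, ((r ^+ n)%:E <= p n)%E) ->
  let rate n := ((n%:R^-1)%:E * lne (p n))%E in
  let root n := poweR (p n) n%:R^-1 in
  [/\ ereal_sup [set rate m | m in [set m | (0 < m)%N]] = (ln rho)%:E,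
    rate @ \oo --> (ln rho)%:E,
    ereal_sup [set root m | m in [set m | (0 < m)%N]] = rho%:E
    & root @ \oo --> rho%:E].
Proof.
move=> rho0 p0 pub plb rate root.
have in0y (x : \bar R) : (0 <= x)%E -> x \in `[0%E, +oo%E].
  by move=> x0; rewrite in_itv/= x0 leey.
have rateX n r : (0 < n)%N -> 0 < r -> ((n%:R^-1)%:E * lne (r ^+ n)%:E)%E = (ln r)%:E.
  move=> n0 r0; rewrite lne_EFin ?exprn_gt0// lnXn// -EFinM -[ln r *+ n]mulr_natl mulKf//.
  by rewrite pnatr_eq0 -lt0n.
have rootX n r : (0 < n)%N -> 0 < r -> poweR (r ^+ n)%:E n%:R^-1 = r%:E.
  move=> n0 r0; rewrite poweR_EFin -powR_mulrn ?ltW// -powRrM mulfV ?powRr1 ?ltW//.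
  by rewrite pnatr_eq0 -lt0n.
have rate_le n (x y : \bar R) : (0 <= x)%E -> (0 <= y)%E -> (x <= y)%E ->
    ((n%:R^-1)%:E * lne x <= (n%:R^-1)%:E * lne y)%E.
  move=> x0 y0 xy; apply: lee_wpmul2l; first by rewrite lee_fin invr_ge0.
  by rewrite lee_lne// in0y.
have rX0 r n : 0 < r -> (0 <= (r ^+ n)%:E)%E.
  by move=> r0; rewrite lee_fin exprn_ge0// ltW.
have root_le n (x y : \bar R) : (0 <= x)%E -> (0 <= y)%E -> (x <= y)%E ->
    (poweR x n%:R^-1 <= poweR y n%:R^-1)%E.
  by move=> x0 y0 xy; apply: gt0_ler_poweR => //; rewrite ?in0y// invr_ge0.
have [] := @cvg_ereal_sup rate (ln rho).
- by move=> n n0; rewrite -(rateX n rho)//; apply: rate_le => //; [exact: rX0|exact: pub].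
(* The ratio [rho * expR (- e)] is the one whose logarithm is [ln rho - e]. *)
- move=> e e0; have r0 : 0 < rho * expR (- e) by rewrite mulr_gt0 ?expR_gt0.
  have := plb (rho * expR (- e)); rewrite r0 gtr_pMr// expR_lt1 oppr_lt0 e0.
  move=> /(_ isT) H; near=> n.
  have n0 : (0 < n)%N by near: n; exact: nbhs_infty_gt.
  rewrite -[X in (_ + X)%:E]expRK -lnM ?posrE ?expR_gt0//.
  by rewrite -(rateX n)//; apply: rate_le => //; [exact: rX0|near: n].
move=> rsup rcvg; have [] := @cvg_ereal_sup root rho.
- by move=> n n0; rewrite -(rootX n rho)//; apply: root_le => //; [exact: rX0|exact: pub].
(* If [rho - e] is not positive, it is no admissible ratio, but the bound then follows from
   nonnegativity of the root. *)
- move=> e e0; have [re|re] := leP (rho - e) 0.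
    by near=> n; rewrite (@le_trans _ _ 0%E)// poweR_ge0.
  have := plb (rho - e); rewrite re gtrDl oppr_lt0 e0 => /(_ isT) H; near=> n.
  have n0 : (0 < n)%N by near: n; exact: nbhs_infty_gt.
  by rewrite -(rootX n)//; apply: root_le => //; [exact: rX0|near: n].
by [].
Unshelve. all: by end_near. Qed.

(** Monotonicity of the logarithm gives one inequality; for the other, a value below [rho * expR e]
    has logarithm below [ln rho + e]. Positivity of [rho] keeps all logarithms finite. *)
Lemma ereal_inf_lne (f : R -> R) rho : 0 < rho ->
  ereal_inf [set (f c)%:E | c in [set c : R | 0 < c]] = rho%:E ->
  ereal_inf [set lne (f c)%:E | c in [set c : R | 0 < c]] = (ln rho)%:E.
Proof.
move=> rho0 infE.
have rhof c : 0 < c -> rho <= f c.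
  by move=> c0; rewrite -lee_fin -infE; apply: ereal_inf_lbound; exists c.
have f0 c : 0 < c -> 0 < f c by move=> c0; rewrite (lt_le_trans rho0)// rhof.
apply/eqP; rewrite eq_le; apply/andP; split; last first.
  apply: le_ereal_inf_tmp => _ [c c0 <-].
  by rewrite lne_EFin ?f0// lee_fin ler_ln ?posrE ?f0// rhof.
apply/lee_addgt0Pr => e e0.
have : (rho%:E < (rho * expR e)%:E)%E by rewrite lte_fin ltr_pMr// expR_gt1.
rewrite -infE => /ereal_inf_lt[_ [c c0 <-]]; rewrite lte_fin => fce.
apply: (@le_trans _ _ (ln (f c))%:E).
  by apply: ereal_inf_lbound; exists c => //; rewrite lne_EFin// f0.
rewrite -EFinD lee_fin -[X in _ + X]expRK -lnM ?posrE ?expR_gt0// ler_ln ?posrE ?f0//.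
  exact: ltW.
by rewrite mulr_gt0 ?expR_gt0.
Qed.

End GeometricRate.

(** * Moment generating functions *)

Section MomentGeneratingFunction.
Context d (T : measurableType d) (R : realType) (P : probability T R).

Lemma integrable_EFinD (f g : T -> R) : P.-integrable setT (EFin \o f) ->
  P.-integrable setT (EFin \o g) -> P.-integrable setT (EFin \o (fun w => f w + g w)).
Proof. by move=> If Ig; exact: (integrableD measurableT If Ig). Qed.

Lemma integrable_EFinB (f g : T -> R) : P.-integrable setT (EFin \o f) ->
  P.-integrable setT (EFin \o g) -> P.-integrable setT (EFin \o (fun w => f w - g w)).
Proof. by move=> If Ig; exact: (integrableB measurableT If Ig). Qed.

Lemma integrable_EFinZ (k : R) (f : T -> R) : P.-integrable setT (EFin \o f) ->
  P.-integrable setT (EFin \o (fun w => k * f w)).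
Proof. by move=> If; exact: (integrableZl measurableT k If). Qed.

Lemma integrable_EFin_cst (k : R) : P.-integrable setT (EFin \o (fun=> k)).
Proof. exact: (finite_measure_integrable_cst P k). Qed.

(** Fatou's lemma in the case where the lower limit is a limit. *)
Lemma integral_le_of_cvg (g : nat -> T -> R) (l : T -> R) (c : R) :
  (forall n, measurable_fun setT (g n)) -> (forall n w, 0 <= g n w) ->
  (forall w, g n w @[n --> \oo] --> l w) ->
  (forall n, \int[P]_w (g n w)%:E <= c%:E)%E ->
  (\int[P]_w (l w)%:E <= c%:E)%E.
Proof.
move=> mg g0 gl gc.
have -> : (\int[P]_w (l w)%:E = \int[P]_w limn_einf (fun n => (g n w)%:E))%E.
  apply: eq_integral => w _; apply/esym.
  have H : (g n w)%:E @[n --> \oo] --> (l w)%:E by apply: cvg_EFin; [apply: nearW|exact: gl].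
  by rewrite is_cvg_limn_einfE; [exact: cvg_lim H|apply/cvg_ex; exists (l w)%:E].
apply: le_trans.
  apply: (fatou P measurableT (f := fun n w => (g n w)%:E)).
  - by move=> n; exact/measurable_EFinP.
  - by move=> n w _; rewrite lee_fin.
rewrite limn_einf_lim; apply: lime_le; first exact: is_cvg_einfs.
apply: nearW => n; apply: le_trans (gc n).
by apply: ereal_inf_lbound; exists n => /=.
Qed.

Variable Y : T -> R.
Hypothesis mY : measurable_fun setT Y.
Hypothesis Yexp : forall c : R, 0 < c -> (\int[P]_w (expR (c * Y w))%:E < +oo)%E.
Let M (c : R) : R := \int[P]_w expR (c * Y w).

Let measurable_expY (c : R) : measurable_fun setT (fun w => expR (c * Y w)).
Proof.
by apply: measurableT_comp => //; exact: measurable_funM.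
Qed.

Lemma integrable_expR (c : R) : 0 < c ->
  P.-integrable setT (EFin \o (fun w => expR (c * Y w))).
Proof.
move=> c0; apply/integrableP; split; first exact/measurable_EFinP.
under eq_integral do rewrite /= ger0_norm ?expR_ge0//.
exact: Yexp.
Qed.

(** Markov's inequality. For [y > 0] it serves twice: as a positive lower bound on [M] uniform in
    [c > 0], and to make [M] grow. *)
Lemma mgf_ge (c y : R) : 0 < c ->
  expR (c * y) * fine (P [set w | y < Y w]) <= M c.
Proof.
move=> c0; set A := [set w | y < Y w]; have mA : measurable A.
  rewrite -[X in measurable X]setTI.
  by have := mY measurableT (measurable_itv `]y, +oo[); rewrite preimage_itvoy.
have PA : (P A < +oo)%E.
  by rewrite (le_lt_trans (probability_le1 _ _)) ?ltry.
rewrite -lee_fin EFinM fineK ?ge0_fin_numE// -[leLHS]/(_ * _)%E.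
rewrite -integral_EFin_Rintegral ?Yexp//.
have -> : P A = (\int[P]_w (\1_A w)%:E)%E.
  by rewrite integral_indic ?setIT.
rewrite -ge0_integralZl_EFin ?expR_ge0//; last exact/measurable_EFinP.
apply: ge0_le_integral => //.
- by apply: measurable_funeM; exact/measurable_EFinP.
- exact/measurable_EFinP.
move=> w _; rewrite -EFinM lee_fin indicE; case: (boolP (w \in _)) => [/set_mem/= yw|_].
  by rewrite mulr1 ler_expR ler_wpM2l ?ltW.
by rewrite mulr0 expR_ge0.
Qed.

(** The pointwise bound is integrated. The condition [0 < a] keeps all exponents positive, where the
    exponential moments are known to be finite. *)
Lemma mgf_second_difference (a b s c h : R) : 0 < a ->
  0 < h <= s -> a <= c - 2 * s -> c + 2 * s <= b ->
  M (c + h) + M (c - h) <= 2 * M c + h ^+ 2 * (16 / s ^+ 2 * (M a + M b)).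
Proof.
move=> a0 hs ac cb; have /andP[h0 hs'] := hs.
have Iab : P.-integrable setT (EFin \o (fun w => expR (a * Y w) + expR (b * Y w))).
  by apply: integrable_EFinD; apply: integrable_expR; lra.
have Ic : P.-integrable setT (EFin \o (fun w => expR (c * Y w))).
  by apply: integrable_expR; lra.
rewrite /M -!RintegralD//; try by apply: integrable_expR; lra.
rewrite -!RintegralZl//; try exact: integrable_EFinZ.
rewrite -RintegralD//; try by do ?apply: integrable_EFinZ.
apply: le_Rintegral => //.
- by apply: integrable_EFinD; apply: integrable_expR; lra.
- by apply: integrable_EFinD; do ?apply: integrable_EFinZ.
- by move=> w _; exact: expR_scaled_second_difference.
Qed.

(** Bernoulli's inequality [k * (x - 1) <= x ^+ k - 1] at [x = expR (y / k)] with [k = n.+1], by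
    induction on the power. *)
Lemma bernoulli_expR n (y : R) : n.+1%:R * (expR (n.+1%:R^-1 * y) - 1) <= expR y - 1.
Proof.
set u := n.+1%:R^-1 * y.
have -> : y = n.+1%:R * u by rewrite mulrA mulfV ?mul1r.
rewrite expRM_natl; have := expR_ge0 u; move: (expR u) => x x0.
elim: n.+1 => [|k IH]; first by rewrite mul0r expr0 subrr.
rewrite -natr1 exprSr; have := exprn_ge0 k x0; move: (x ^+ k) IH => z IH z0.
have : 0 <= k%:R * (x - 1) ^+ 2 by rewrite mulr_ge0 ?sqr_ge0.
have := ler_wpM2r x0 IH; rewrite expr2; lra.
Qed.

Lemma cvg_expR_divS (y : R) : expR (n.+1%:R^-1 * y) @[n --> \oo] --> (1 : R).
Proof.
have : expR (n.+1%:R^-1 * y) @[n --> \oo] --> expR (0 * y).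
  apply: continuous_cvg; first exact: continuous_expR.
  by apply: cvgM; [exact: cvg_harmonic|exact: cvg_cst].
by rewrite mul0r expR0.
Qed.

(** With [u = y / n.+1], the inequalities [u <= expR u - 1 <= u * expR u] squeeze the sequence
    between [y] and [y * expR u]. *)
Lemma cvg_expR_slope (y : R) :
  n.+1%:R * (expR (n.+1%:R^-1 * y) - 1) @[n --> \oo] --> y.
Proof.
apply: (@squeeze_cvgr _ _ _ _ (fun=> y) (fun n => y * expR (n.+1%:R^-1 * y))).
- apply: nearW => n; have n0 : 0 < n.+1%:R :> R by [].
  apply/andP; split.
    by rewrite -ler_pdivrMl// lerBrDl expR_ge1Dx.
  rewrite -ler_pdivlMl// mulrA; move: (_ * y) => u.
  have : expR u * (1 - u) <= expR u * expR (- u).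
    by rewrite ler_wpM2l ?expR_ge0// expR_ge1Dx.
  by rewrite expRxMexpNx_1; lra.
- exact: cvg_cst.
- rewrite -[X in _ --> X]mulr1; apply: cvgM; first exact: cvg_cst.
  exact: cvg_expR_divS.
Qed.

(* Fatou's lemma for [expR Y - 1 - n.+1%:R * (expR (Y / n.+1%:R) - 1) >= 0]: if [M]
   were at least [1] at every [n.+1%:R^-1], then [Y] would be integrable with a
   nonnegative mean. *)
Lemma mgf_lt1 (Z : T -> R) : P.-integrable setT (EFin \o Z) ->
  (\int[P]_w (Z w)%:E = 0)%E -> (forall w, Y w <= Z w) ->
  P [set w | Y w < Z w] = 1%E -> exists n, M n.+1%:R^-1 < 1.
Proof.
move=> IZ Z0 YZ PYZ; apply: contrapT => noM.
have M1 n : 1 <= M n.+1%:R^-1 by rewrite leNgt; apply/negP => Mn; apply: noM; exists n.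
have I1 : P.-integrable setT (EFin \o (fun w => expR (Y w) - 1)).
  apply: integrable_EFinB.
    by have := integrable_expR ltr01; under [X in EFin \o X]eq_fun do rewrite mul1r.
  exact: integrable_EFin_cst.
have I2 n : P.-integrable setT
    (EFin \o (fun w => n.+1%:R * (expR (n.+1%:R^-1 * Y w) - 1))).
  apply: integrable_EFinZ.
  apply: integrable_EFinB; first exact: integrable_expR.
  exact: integrable_EFin_cst.
pose g n w := expR (Y w) - 1 - n.+1%:R * (expR (n.+1%:R^-1 * Y w) - 1).
have g0 n w : 0 <= g n w by rewrite subr_ge0 bernoulli_expR.
have Ig n : P.-integrable setT (EFin \o g n) by exact: integrable_EFinB.
pose l w := expR (Y w) - 1 - Y w.
have l0 w : 0 <= l w by rewrite /l; have := expR_ge1Dx (Y w); lra.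
have ml : measurable_fun setT l.
  apply: measurable_funB => //; apply: measurable_funB => //.
  exact: measurableT_comp.
have int1 : \int[P]_w 1 = 1 :> R.
  by rewrite Rintegral_cst// mul1r; exact: (congr1 fine (probability_setT P)).
have M1E : M 1 = \int[P]_w expR (Y w) by apply: eq_Rintegral => w _; rewrite mul1r.
have gl : (\int[P]_w (l w)%:E <= (M 1 - 1)%:E)%E.
  apply: (@integral_le_of_cvg g).
  - by move=> n; apply/measurable_EFinP; exact: measurable_int (Ig n).
  - exact: g0.
  - by move=> w; apply: cvgB; [exact: cvg_cst|exact: cvg_expR_slope].
  move=> n; rewrite integral_EFin_Rintegral//; last first.
    have /integrableP[_] := Ig n.
    by under eq_integral do rewrite /= ger0_norm//.
  rewrite lee_fin RintegralB// RintegralB//; last 2 first.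
  - by have := integrable_expR ltr01; under [X in EFin \o X]eq_fun do rewrite mul1r.
  - exact: integrable_EFin_cst.
  rewrite RintegralZl//; last first.
    apply: integrable_EFinB; first exact: integrable_expR.
    exact: integrable_EFin_cst.
  rewrite RintegralB//; last 2 first.
  - exact: integrable_expR.
  - exact: integrable_EFin_cst.
  rewrite -/(M _) int1 M1E.
  by rewrite gerBl mulr_ge0// subr_ge0.
have Il : P.-integrable setT (EFin \o l).
  apply/integrableP; split; first exact/measurable_EFinP.
  under eq_integral do rewrite /= ger0_norm//.
  by rewrite (le_lt_trans gl)// ltry.
(* Integrability of [Y] is not assumed: it comes from writing [Y] as the difference of [expR Y - 1]
   and [l], both integrable. *)
have IY : P.-integrable setT (EFin \o Y).
  have -> : EFin \o Y = EFin \o (fun w => (expR (Y w) - 1) - l w).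
    by apply/funext => w /=; congr EFin; rewrite /l; lra.
  exact: integrable_EFinB.
have IZY : P.-integrable setT (EFin \o (fun w => Z w - Y w)).
  exact: integrable_EFinB.
have Y0 : 0 <= \int[P]_w Y w.
  have -> : \int[P]_w Y w = \int[P]_w ((expR (Y w) - 1) - l w).
    by apply: eq_Rintegral => w _; rewrite /l; lra.
  rewrite RintegralB// RintegralB//; last 2 first.
  - by have := integrable_expR ltr01; under [X in EFin \o X]eq_fun do rewrite mul1r.
  - exact: integrable_EFin_cst.
  move: (gl); rewrite integral_EFin_Rintegral//; last by rewrite (le_lt_trans gl)// ltry.
  rewrite lee_fin int1 M1E.
  by rewrite subr_ge0.
(* Since [Z] has mean 0, [Y] has a nonnegative mean and [Y <= Z], the difference [Z - Y] integrates
   to 0. So [Y = Z] almost everywhere, against [Y < Z] with probability 1. *)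
have ZY0 : (\int[P]_w `|(Z w - Y w)%:E| = 0)%E.
  under eq_integral do rewrite abse_EFin ger0_norm ?subr_ge0//.
  apply/eqP; rewrite eq_le integral_ge0 ?andbT; last first.
    by move=> w _; rewrite lee_fin subr_ge0.
  rewrite integral_EFin_Rintegral; last 2 first.
  - by move=> w; rewrite subr_ge0.
  - have /integrableP[_] := IZY.
    by under eq_integral do rewrite /= ger0_norm ?subr_ge0//.
  by rewrite RintegralB// lee_fin {1}/Rintegral Z0/= sub0r oppr_le0.
have mZY : measurable_fun setT (fun w => (Z w - Y w)%:E) by exact: measurable_int IZY.
have [N [mN PN0 Nsub]] := (ae_eq_integral_abs P measurableT mZY).1 ZY0.
set A := [set w | Y w < Z w] in PYZ; have : (P A <= P N)%E.
  have mYZ : measurable A.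
    rewrite -[X in measurable X]setTI; apply: measurable_fun_ltr => //.
    by apply/measurable_EFinP; exact: measurable_int IZ.
  apply: le_measure => [||w /= YZw]; [exact: mem_set|exact: mem_set|]; apply: Nsub => /(_ I)/= /eqP.
  by rewrite eqe subr_eq0 gt_eqF.
by rewrite PYZ PN0 lee_fin ler10.
Qed.

(** If [M] never decreased, it would stay below [M n.+1%:R^-1 < 1] at all smaller reciprocals. But
    the exponentials tend pointwise to 1 there, so Fatou's lemma would give [1 <= M n.+1%:R^-1]. *)
Lemma mgf_decreases (Z : T -> R) : P.-integrable setT (EFin \o Z) ->
  (\int[P]_w (Z w)%:E = 0)%E -> (forall w, Y w <= Z w) ->
  P [set w | Y w < Z w] = 1%E -> exists a b, 0 < a < b /\ M b < M a.
Proof.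
move=> IZ Z0 YZ PYZ; have [n Mn] := mgf_lt1 IZ Z0 YZ PYZ.
apply: contrapT => noab.
have Mk k : M (n + k.+1).+1%:R^-1 <= M n.+1%:R^-1.
  rewrite leNgt; apply/negP => Mk; apply: noab.
  exists (n + k.+1).+1%:R^-1, n.+1%:R^-1; split => //.
  by rewrite invr_gt0 ltr0n/= ltf_pV2 ?posrE// ltr_nat ltnS addnS ltnS leq_addr.
have : (\int[P]_w 1%:E <= (M n.+1%:R^-1)%:E)%E.
  apply: (@integral_le_of_cvg (fun k w => expR ((n + k.+1).+1%:R^-1 * Y w))).
  - by [].
  - by move=> k w; exact: expR_ge0.
  - move=> w; pose v k := expR (k.+1%:R^-1 * Y w).
    have -> : (fun k => expR ((n + k.+1).+1%:R^-1 * Y w)) = (fun k => v (k + n.+1)%N).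
      by apply/funext => k; rewrite /v addnS -addSn addnC.
    by rewrite (cvg_shiftn n.+1 v); exact: cvg_expR_divS.
  - by move=> k; rewrite integral_EFin_Rintegral ?Yexp// lee_fin; exact: Mk.
have -> : (\int[P]_w 1%:E = 1)%E.
  by rewrite integral_cst// mul1e; exact: probability_setT.
rewrite lee_fin => M1.
by have := lt_le_trans Mn M1; rewrite ltxx.
Qed.

(** By [mgf_ge] and [1 + c * y <= expR (c * y)], [M] grows at least linearly. The point found has
    the form [a + m * (b - a)] so that it lies on every grid from [a] that subdivides [b - a]
    evenly. *)
Lemma mgf_grows (a b y : R) : 0 < a < b -> 0 < y ->
  0 < fine (P [set w | y < Y w]) -> exists m : nat, M a < M (a + m%:R * (b - a)).
Proof.
move=> /andP[a0 ab] y0; set q := fine _ => q0.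
have k0 : 0 < (b - a) * y * q by rewrite !mulr_gt0// subr_gt0.
pose m := Num.bound (M a / ((b - a) * y * q)).
have Ma0 : 0 <= M a by apply: Rintegral_ge0 => w _; exact: expR_ge0.
have Mm : M a < m%:R * ((b - a) * y * q).
  by rewrite -ltr_pdivrMr// archi_boundP// divr_ge0// ltW.
exists m; rewrite (lt_le_trans Mm)//.
have c0 : 0 < a + m%:R * (b - a).
  by rewrite ltr_wpDr// mulr_ge0// subr_ge0 ltW.
rewrite (le_trans _ (mgf_ge y c0))// -/q !mulrA ler_wpM2r ?(ltW q0)//.
rewrite (le_trans _ (expR_ge1Dx _))// mulrDl -mulrA addrA lerDr addr_ge0//.
by rewrite mulr_ge0// ltW.
Qed.

End MomentGeneratingFunction.

(** * Upper and lower tail bounds for sums of independent identically distributed variables *)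

Section Cramer.
Context d (T : measurableType d) (R : realType) (P : probability T R).
Variables (X : nat -> {RV P >-> R}) (g : R -> R).
Hypothesis X_indep : mutually_independent P X.
Hypothesis X_ident : identically_distributed P X.
Hypothesis mg : measurable_fun setT g.
Hypothesis g_exp : forall c : R, 0 < c ->
  (\int[P]_w (expR (c * g (X 0%N w)))%:E < +oo)%E.
Let S n w : R := \sum_(i < n) g (X i w).
Let M (c : R) : R := \int[P]_w expR (c * g (X 0%N w)).

Let measurable_S n : measurable_fun setT (S n).
Proof.
by apply: measurable_sum => i; apply: measurableT_comp => //; exact: measurable_funP.
Qed.

Let measurable_expS n (c : R) : measurable_fun setT (fun w => expR (c * S n w)).
Proof. by apply: measurableT_comp => //; exact: measurable_funM. Qed.

Let measurable_S_ge0 n : measurable [set w | 0 <= S n w].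
Proof.
rewrite -[X in measurable X]setTI.
by have := measurable_S n measurableT (measurable_itv `[0, +oo[); rewrite preimage_itvcy.
Qed.

Lemma integral_identically_distributed (f : R -> R) i :
  measurable_fun setT f -> (forall t, 0 <= f t) ->
  (\int[P]_w (f (X i w))%:E = \int[P]_w (f (X 0%N w))%:E)%E.
Proof.
move=> mf f0.
have mfE : measurable_fun setT (fun t : R => (f t)%:E) by exact/measurable_EFinP.
have f0E t : (0 <= (f t)%:E)%E by rewrite lee_fin.
rewrite -(ge0_integral_distribution (X i) mfE f0E).
rewrite -(ge0_integral_distribution (X 0%N) mfE f0E).
by apply: eq_measure_integral => A mA _; exact: X_ident.
Qed.

Lemma mgf_sum (c : R) n : 0 < c -> (\int[P]_w (expR (c * S n w))%:E = (M c ^+ n)%:E)%E.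
Proof.
move=> c0.
have mF : measurable_fun setT (fun t => expR (c * g t)).
  by apply: measurableT_comp => //; exact: measurable_funM.
have F0 t : 0 <= expR (c * g t) by exact: expR_ge0.
transitivity (\int[P]_w (\prod_(i < n) expR (c * g (X i w)))%:E)%E.
  by apply: eq_integral => w _; congr EFin; rewrite -expR_sum mulr_sumr.
rewrite (@independent_integral_prod _ _ _ P X n (fun _ t => expR (c * g t)))//.
  congr EFin; rewrite -[n in RHS]card_ord -prodr_const; apply: eq_bigr => i _.
  by congr fine; exact: (integral_identically_distributed i mF F0).
by move=> i; rewrite (integral_identically_distributed i mF F0) g_exp.
Qed.

Let integrable_expS n (c : R) : 0 < c ->
  P.-integrable setT (EFin \o (fun w => expR (c * S n w))).
Proof.
move=> c0; apply/integrableP; split; first exact/measurable_EFinP.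
under eq_integral do rewrite /= ger0_norm ?expR_ge0//.
by rewrite mgf_sum// ltry.
Qed.

(** Chernoff's bound: the indicator of [0 <= S n] is at most [expR (c * S n)]. *)
Lemma sum_tail_le_mgf (c : R) n : 0 < c -> (P [set w | (0 <= S n w)%R] <= (M c ^+ n)%:E)%E.
Proof.
move=> c0; set A := [set w | 0 <= S n w].
rewrite -mgf_sum// -[A]setIT -integral_indic//; last exact: measurable_S_ge0.
apply: ge0_le_integral => //.
- by apply/measurable_EFinP; apply: measurable_indic; exact: measurable_S_ge0.
- exact/measurable_EFinP.
move=> w _; rewrite lee_fin indicE; case: (boolP (w \in _)) => [/set_mem/= Sw|_].
  by rewrite -expR0 ler_expR mulr_ge0// ltW.
exact: expR_ge0.
Qed.

(* The first two terms bound [expR (c * S n w)] where [S n w < 0] and where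
   [S n w > n%:R * eps]; this replaces the change of measure in the usual proof of
   Cramer's lower bound. *)
Lemma mgf_le_tail (n : nat) (c h eps : R) : 0 < h < c ->
  M c ^+ n <= M (c - h) ^+ n + (expR (- (eps * h)) * M (c + h)) ^+ n
    + expR (c * eps) ^+ n * fine (P [set w | 0 <= S n w]).
Proof.
move=> /andP[h0 hc]; have c0 : 0 < c by lra.
have ch0 : 0 < c - h by lra.
have ch1 : 0 < c + h by lra.
have ME c' : 0 < c' -> M c' ^+ n = \int[P]_w expR (c' * S n w).
  by move=> c'0; rewrite /Rintegral mgf_sum.
pose A := [set w | 0 <= S n w].
have mA : measurable A := measurable_S_ge0 n.
have PAE : fine (P A) = \int[P]_w \1_A w.
  by rewrite /Rintegral integral_indic ?setIT.
have IA : P.-integrable setT (EFin \o \1_A).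
  apply/integrableP; split; first by apply/measurable_EFinP; exact: measurable_indic.
  under eq_integral do rewrite /= ger0_norm//.
  by rewrite integral_indic// setIT (le_lt_trans (probability_le1 _ _)) ?ltry.
rewrite exprMn !ME// -/A PAE -!RintegralZl//; try exact: integrable_expS.
have I1 := integrable_expS n ch0.
have I2 := integrable_EFinZ (expR (- (eps * h)) ^+ n) (integrable_expS n ch1).
have I3 := integrable_EFinZ (expR (c * eps) ^+ n) IA.
rewrite -RintegralD// -RintegralD//; last exact: integrable_EFinD.
apply: le_Rintegral => //.
- exact: integrable_expS.
- by apply: integrable_EFinD => //; exact: integrable_EFinD.
move=> w _; rewrite -!expRM_natl -expRD indicE.
have E0 (y : R) := expR_ge0 y.
have [Sneg|Spos] := ltP (S n w) 0.
  rewrite (@le_trans _ _ (expR ((c - h) * S n w)))//.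
    by rewrite ler_expR; nra.
  by rewrite -addrA lerDl addr_ge0// mulr_ge0.
rewrite mem_set// mulr1; have [Sle|Sgt] := leP (S n w) (n%:R * eps).
  rewrite (@le_trans _ _ (expR (n%:R * (c * eps))))//.
    by rewrite ler_expR mulrCA ler_wpM2l// ltW.
  by rewrite lerDr addr_ge0.
rewrite (@le_trans _ _ (expR (n%:R * - (eps * h) + (c + h) * S n w)))//.
  rewrite ler_expR mulrDl mulrN mulrA addrCA lerDl addrC subr_ge0 mulrC.
  by rewrite ler_wpM2l// ltW.
by rewrite addrAC lerDr addr_ge0.
Qed.

End Cramer.

(** * Deviation means *)

Section DeviationMean.
Context {R : realType}.
Variables (I : set R) (D : R -> R -> R).
Hypothesis I_itv : is_interval I.
Hypothesis D_dev : deviation I D.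

Lemma deviation_sum_lt n (y : 'I_n -> R) s t : (0 < n)%N ->
  (forall i, I (y i)) -> I s -> I t -> s < t ->
  \sum_(i < n) D (y i) t < \sum_(i < n) D (y i) s.
Proof.
move=> n0 yI Is It st; have [Ddec _ _] := D_dev.
rewrite (bigD1 (Ordinal n0))//= [ltRHS](bigD1 (Ordinal n0))//=.
rewrite ltr_leD ?Ddec//; apply: ler_sum => i _.
by rewrite ltW// Ddec.
Qed.

(** Intermediate value theorem between the least and the greatest [y k]: as [D (y k)] decreases and
    vanishes at [y k], the sum is nonnegative at the former and nonpositive at the latter. *)
Lemma deviation_sum_root n (y : 'I_n -> R) : (0 < n)%N -> (forall i, I (y i)) ->
  exists t, I t /\ \sum_(i < n) D (y i) t = 0.
Proof.
move=> n0 yI; have [Ddec Dcont D0] := D_dev.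
have Dle z s t : I z -> I s -> I t -> s <= t -> D z t <= D z s.
  move=> Iz Is It; rewrite le_eqVlt => /predU1P[->//|st].
  by rewrite ltW// Ddec.
case: (@arg_minP _ _ _ (Ordinal n0) xpredT y isT) => i _ imin.
case: (@arg_maxP _ _ _ (Ordinal n0) xpredT y isT) => j _ jmax.
have yij : y i <= y j by exact: imin.
have subI : `[y i, y j] `<=` I.
  by move=> t /=; rewrite in_itv/= => /andP[it tj]; apply: (I_itv (yI i) (yI j)); rewrite it tj.
have Fi : 0 <= \sum_(k < n) D (y k) (y i).
  by apply: sumr_ge0 => k _; rewrite -(D0 (y k))// Dle// imin.
have Fj : \sum_(k < n) D (y k) (y j) <= 0.
  by apply: sumr_le0 => k _; rewrite -(D0 (y k))// Dle//; exact: jmax.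
have cF : {within `[y i, y j], continuous (fun t => \sum_(k < n) D (y k) t)}.
  apply: continuous_subspaceW subI _.
  by apply: continuous_big => [|k _]; [exact: add_continuous|exact: Dcont].
have [|t tij Ft] := IVT (v := 0) yij cF.
  by rewrite ge_min Fj orbT le_max Fi.
by exists t; split => //; exact: subI.
Qed.

(** The sum vanishes at the root chosen by [get] and is strictly decreasing, so its sign at [x]
    tells on which side of that root [x] lies. *)
Lemma deviation_mean_geE n (y : 'I_n -> R) x : (0 < n)%N -> (forall i, I (y i)) ->
  I x -> (x <= deviation_mean I D y) = (0 <= \sum_(i < n) D (y i) x).
Proof.
move=> n0 yI Ix; rewrite /deviation_mean.
have [] := getPex (deviation_sum_root n0 yI).
set t := get _ => It Ft; apply/idP/idP => [|F0].
  rewrite le_eqVlt => /predU1P[->|xt]; first by rewrite Ft.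
  by have := deviation_sum_lt n0 yI Ix It xt; rewrite Ft => /ltW.
rewrite leNgt; apply/negP => tx.
by have := deviation_sum_lt n0 yI It Ix tx; rewrite Ft ltNge F0.
Qed.

End DeviationMean.

Lemma measure_setI_full d (T : measurableType d) (R : realType) (P : probability T R)
    (A B : set T) : measurable A -> measurable B -> P B = 1%E -> P (A `&` B) = P A.
Proof.
move=> mA mB PB; have PB0 : P (~` B) = 0%E by rewrite probability_setC// PB subee.
have PAB : (P : {measure set T -> \bar R}) (A `\` B) = 0%E.
  apply/eqP; rewrite -measure_le0 -PB0; apply: le_measure => [||w []//]; apply: mem_set.
  - exact: measurableD.
  - exact: measurableC.
apply/esym/(etrans (measureDI P mA mB)).
exact: (etrans (congr1 (fun z => z + _)%E PAB) (add0e _)).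
Qed.

(** The first event lies in the event [J] that the first [n] variables take values in [I], and there
    it agrees with the second. Outside [J] the two may differ, because the restriction puts 0 for
    undefined deviations; but [J] has probability 1 by independence. *)
Lemma deviation_mean_geE_measure d (T : measurableType d) (R : realType)
    (P : probability T R) (I : set R) (D : R -> R -> R) (xi : nat -> {RV P >-> R})
    (x : R) n :
  is_interval I -> deviation I D -> mutually_independent P xi ->
  identically_distributed P xi -> borel_in_first_variable I D ->
  P (xi 0%N @^-1` I) = 1%E -> I x -> (0 < n)%N ->
  P (deviation_mean_ge I D xi n x) =
  P [set w | 0 <= \sum_(i < n) ((D ^~ x) \_ I) (xi i w)].
Proof.
move=> Iitv Ddev indep ident mD xiI Ix n0.
have mI : measurable I by exact: is_interval_measurable.
have mg : measurable_fun setT ((D ^~ x) \_ I).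
  exact: (measurable_restrictT _ mI).1 (mD _ Ix).
pose J := \bigcap_(i in [set` [fset i in iota 0 n]%fset]) (xi i @^-1` I).
have PJ : P J = 1%E.
  apply: (etrans (indep _ (fun=> I) (fun=> mI))); apply: big1 => i _.
  by rewrite (ident i 0%N).
have mJ : measurable J.
  apply: fin_bigcap_measurable => [|i _]; first exact: finite_fset.
  exact: measurable_funPTI.
have JP w : J w <-> forall i : 'I_n, I (xi i w).
  split => [Jw i|Iw i]; first by apply: Jw; rewrite /= !inE mem_iota/= ltn_ord.
  by rewrite /= !inE mem_iota/= add0n => lin; exact: (Iw (Ordinal lin)).
rewrite -[in RHS](@measure_setI_full _ _ _ _ _ J)//; last first.
  rewrite -[X in measurable X]setTI.
  have mS : measurable_fun setT (fun w => \sum_(i < n) ((D ^~ x) \_ I) (xi i w)).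
    by apply: measurable_sum => i; apply: measurableT_comp => //; exact: measurable_funP.
  by have := mS measurableT _ (measurable_itv `[0, +oo[); rewrite preimage_itvcy.
congr (P _); apply/seteqP; split => w /=.
  move=> [Iw]; rewrite deviation_mean_geE// => Dw; split; last exact/JP.
  by under eq_bigr do rewrite patchE mem_set//.
move=> [+ /JP Iw]; under eq_bigr do rewrite patchE mem_set//.
by move=> Dw; split => //; rewrite deviation_mean_geE.
Qed.

(** The [n]-th root of [r] is a lower bound of [A]. This turns the bounds [M c ^+ n], one for each
    [c], into the single bound [rho ^+ n] for the infimum [rho]. *)
Lemma le_exprn_inf (R : realType) (A : set R) (r : R) n : (0 < n)%N -> 0 <= r ->
  A !=set0 -> (forall z, A z -> 0 <= z /\ r <= z ^+ n) -> r <= inf A ^+ n.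
Proof.
move=> n0 r0 A0 rA; have nN0 : n%:R != 0 :> R by rewrite pnatr_eq0 -lt0n.
have rE : (r `^ n%:R^-1) ^+ n = r.
  by rewrite -powR_mulrn ?powR_ge0// -powRrM mulVf// powRr1.
have rinf : r `^ n%:R^-1 <= inf A.
  apply: lb_le_inf => // z Az; have [z0 rz] := rA z Az.
  by rewrite -(ler_pXn2r n0) ?nnegrE ?powR_ge0// rE.
by rewrite -{1}rE lerXn2r// nnegrE ?powR_ge0// (le_trans _ rinf)// powR_ge0.
Qed.

Theorem theorem6p1 (R : realType) (d : measure_display) (T : measurableType d)
  (P : probability T R) (I : set R) (D : R -> R -> R)
  (xi : nat -> {RV P >-> R}) (t0 : R)
  (I_interval : nondegenerate_interval I)
  (D_deviation : deviation I D)
  (xi_independent : mutually_independent P xi)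
  (xi_identically_distributed : identically_distributed P xi)
  (D_measurable : borel_in_first_variable I D)
  (xi_in_I : P (xi 0%N @^-1` I) = 1%E)
  (D_nondegenerate : forall x, I x ->
    nondegenerate_rv P (deviation_rv I D (xi 0%N) x))
  (mgf_finite : forall c x : R, 0 < c -> I x ->
    (deviation_mgf P I D (xi 0%N) c x < +oo)%E)
  (t0_mean : is_deviation_mean_rv P I D (xi 0%N) t0)
  (x : R) (x_in_I : I x) (t0_lt_x : t0 < x)
  (esssup_gt0 : (0 < esssup P (deviation_rv I D (xi 0%N) x))%E) :
  let p (n : nat) := P (deviation_mean_ge I D xi n x) in
  let phi (c : R) := deviation_mgf P I D (xi 0%N) c x in
  let rate (n : nat) := ((n%:R^-1)%:E * lne (p n))%E in
  let root (n : nat) := poweR (p n) n%:R^-1 in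
  [/\ rate @ \oo --> ereal_sup [set rate m | m in [set m | (0 < m)%N]],
      ereal_sup [set rate m | m in [set m | (0 < m)%N]]
        = ereal_inf [set lne (phi c) | c in [set c : R | 0 < c]],
      root @ \oo --> ereal_sup [set root m | m in [set m | (0 < m)%N]]
    & ereal_sup [set root m | m in [set m | (0 < m)%N]]
        = ereal_inf [set phi c | c in [set c : R | 0 < c]]].
Proof.
move=> p phi rate root.
have [I_itv _] := I_interval.
have mI : measurable I by exact: is_interval_measurable.
have [Ddec _ _] := D_deviation.
have [[t0_in_I t0_int] t0_zero] := t0_mean.
pose g t := (D ^~ t) \_ I.
have mg t : I t -> measurable_fun setT (g t).
  by move=> It; exact: (measurable_restrictT _ mI).1 (D_measurable _ It).
have mgxi t : I t -> measurable_fun setT (fun w => g t (xi 0%N w)).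
  by move=> It; apply: measurableT_comp; [exact: mg|exact: measurable_funP].
pose M (c : R) : R := \int[P]_w expR (c * g x (xi 0%N w)).
have expE (X : T -> R) : ('E_P[X] = \int[P]_w (X w)%:E)%E by rewrite unlock.
have expY (c : R) : 0 < c -> (\int[P]_w (expR (c * g x (xi 0%N w)))%:E < +oo)%E.
  by move=> c0; rewrite -expE; exact: mgf_finite.
have phiE (c : R) : 0 < c -> phi c = (M c)%:E.
  by move=> c0; rewrite /phi /deviation_mgf expE integral_EFin_Rintegral ?expY.
pose A n := [set w | 0 <= \sum_(i < n) g x (xi i w)].
have pE n : (0 < n)%N -> p n = P (A n) by move=> n0; exact: deviation_mean_geE_measure.
(* A positive essential supremum exceeds 0 at some [y > 0] with [P (Y <= y) < 1], that is, [Y > y]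
   with positive probability. *)
have [y y0 q0] : exists2 y, 0 < y & 0 < fine (P [set w | y < g x (xi 0%N w)]).
  have [_ [y Py <-]] := ereal_sup_gt esssup_gt0; rewrite lte_fin => y0.
  exists y => //; set B := [set w | _].
  have mB : measurable B.
    rewrite -[X in measurable X]setTI.
    by have := mgxi _ x_in_I measurableT _ (measurable_itv `]y, +oo[); rewrite preimage_itvoy.
  have CB : ~` B = [set w | deviation_rv I D (xi 0%N) x w <= y].
    by apply/seteqP; split => w /=; rewrite leNgt => /negP.
  rewrite fine_gt0// (le_lt_trans (probability_le1 P mB)) ?ltry// andbT.
  rewrite lt_neqAle measure_ge0 andbT eq_sym; apply/eqP => PB0.
  have : (P (~` B) < 1)%E by rewrite CB.
  by rewrite probability_setC// PB0 sube0 ltxx.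
(* The comparison variable is the deviation at [t0], of mean 0. As [t0 < x], it strictly exceeds the
   deviation at [x] on the almost sure event that [xi 0] lies in [I]; off that event both are 0. *)
have [a [b [ab Mba]]] : exists a b, 0 < a < b /\ M b < M a.
  apply: (@mgf_decreases _ _ _ P _ (mgxi _ x_in_I) expY (fun w => g t0 (xi 0%N w))).
  - apply/integrableP; split; first exact/measurable_EFinP/mgxi.
    by move: t0_int; rewrite expE.
  - by rewrite -expE.
  - move=> w; rewrite /g !patchE; case: ifPn => // /set_mem Iw.
    by rewrite ltW// Ddec.
  - have -> // : [set w | g x (xi 0%N w) < g t0 (xi 0%N w)] = xi 0%N @^-1` I.
    apply/seteqP; split => w /=; rewrite /g !patchE.
      by case: ifPn => [/set_mem//|_]; rewrite ltxx.
    by move=> Iw; rewrite mem_set// Ddec.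
have /andP[a0 ab'] := ab.
have [m Mm] := mgf_grows (mgxi _ x_in_I) expY ab y0 q0.
set q := fine _ in q0.
have qM c : 0 < c -> q <= M c.
  move=> c0; rewrite (le_trans _ (mgf_ge (mgxi _ x_in_I) expY y c0))//.
  by rewrite ler_peMl ?(ltW q0)// -expR0 ler_expR mulr_ge0// ltW.
set C := a + m%:R * (b - a) in Mm.
have aC : a <= C by rewrite lerDl mulr_ge0// subr_ge0 ltW.
(* For [c] between [a] and [C], the points [c - 2 * s] and [c + 2 * s] then lie between [a / 2 > 0]
   and [C + a / 2], so one constant serves all second differences. *)
pose s := a / 4; have s0 : 0 < s by rewrite divr_gt0.
have flat := @exists_flat_increase _ M a b m q
  (16 / s ^+ 2 * (M (a / 2) + M (C + a / 2))) s ab Mba Mm q0 qM s0.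
pose rho := inf [set M c | c in [set c : R | 0 < c]].
have M_lb : has_lbound [set M c | c in [set c : R | 0 < c]].
  by exists q => _ [c c0 <-]; exact: qM.
have M_neq0 : [set M c | c in [set c : R | 0 < c]] !=set0 by exists (M 1); exists 1 => /=.
have rhoM c : 0 < c -> rho <= M c.
  by move=> c0; apply: ge_inf => //; exists c.
have rho0 : 0 < rho.
  by rewrite (lt_le_trans q0)//; apply: lb_le_inf => // _ [c c0 <-]; exact: qM.
have infM : ereal_inf [set (M c)%:E | c in [set c : R | 0 < c]] = rho%:E.
  by rewrite -ereal_inf_EFin// image_comp.
have pM n (c : R) : (0 < n)%N -> 0 < c -> (p n <= (M c ^+ n)%:E)%E.
  move=> n0 c0; rewrite pE//.
  exact: (@sum_tail_le_mgf _ _ _ P xi (g x) xi_independent xi_identically_distributed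
    (mg _ x_in_I) expY c n c0).
have [rateE rate_cvg rootE root_cvg] : [/\
    ereal_sup [set rate m | m in [set m | (0 < m)%N]] = (ln rho)%:E,
    rate @ \oo --> (ln rho)%:E,
    ereal_sup [set root m | m in [set m | (0 < m)%N]] = rho%:E
    & root @ \oo --> rho%:E].
  apply: geometric_rate => //.
  - move=> n n0; have pfin : p n \is a fin_num.
      rewrite ge0_fin_numE ?measure_ge0//.
      by rewrite (le_lt_trans (pM n 1 n0 ltr01))// ltry.
    rewrite -(fineK pfin) lee_fin; apply: le_exprn_inf => //.
      exact/fine_ge0/measure_ge0.
    move=> _ [c c0 <-]; rewrite (le_trans (ltW q0)) ?qM//; split => //.
    by rewrite -lee_fin fineK// pM.
  - move=> r rrho.
    have pA : \forall n \near \oo, r ^+ n <= fine (P (A n)).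
      apply: (@eventually_geometric_le _ _ M rho C rhoM _ _ _ r rrho).
      - exact: lt_le_trans aC.
      - apply: flat => c h /andP[ac cC] hs.
        by apply: (mgf_second_difference (mgxi _ x_in_I) expY) => //; rewrite /s /C; lra.
      - move=> n c h eps; exact: (@mgf_le_tail _ _ _ P xi (g x)
          xi_independent xi_identically_distributed (mg _ x_in_I) expY n c h eps).
    near=> n; have n0 : (0 < n)%N by near: n; exact: nbhs_infty_gt.
    have PAfin : P (A n) \is a fin_num.
      by rewrite -pE// ge0_fin_numE ?measure_ge0// (le_lt_trans (pM n 1 n0 ltr01))// ltry.
    by rewrite pE// -(fineK PAfin) lee_fin; near: n.
have phi_set : [set phi c | c in [set c : R | 0 < c]] =
    [set (M c)%:E | c in [set c : R | 0 < c]].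
  by apply: eq_imagel => c c0; exact: phiE.
have lnphi_set : [set lne (phi c) | c in [set c : R | 0 < c]] =
    [set lne (M c)%:E | c in [set c : R | 0 < c]].
  by apply: eq_imagel => c c0; rewrite phiE.
rewrite rateE rootE phi_set lnphi_set infM (ereal_inf_lne rho0 infM).
by split.
Unshelve. all: by end_near. Qed.
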